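(* Let $R$ be a commutative ring with $1 \neq 0$ and $I$ an ideal of $R$. The following are equivalent: (i) $I$ has $( * )$; (ii) $R^\times + I$ is saturated; (iii) $R^\times + I = (1 + I)^\sim$; (iv) for any $a \in R$ such that $1 - ab \in I$ for some $b \in R$, there exists $u \in R^\times$ with $1 - au \in I$.
   Context: An ideal $I$ of $R$ has $( * )$ if the canonical surjection $R \twoheadrightarrow R/I$ induces a surjective group homomorphism $R^\times \to (R/I)^\times$ on unit groups. For a multiplicative set $W \subseteq R$, its saturation is $W^\sim := \{ r \in R \mid \exists s \in R,\ sr \in W\}$, and $W$ is called saturated if $W = W^\sim$. Here $R^\times + I = \{u + x : u \in R^\times, x \in I\}$ and $1 + I = \{1 + x : x \in I\}$. *)

(* Defs.v *)
From HB Require Import structures.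
From mathcomp Require Import all_boot all_algebra.
From mathcomp Require Import boolp classical_sets functions.

Set Implicit Arguments.
Unset Strict Implicit.
Unset Printing Implicit Defensive.

Import GRing.Theory.

Local Open Scope classical_set_scope.
Local Open Scope ring_scope.

(* Unlike ring_quotient.idealr, this neither excludes I = R nor asks membership
   to be a boolean. *)
Record ideal (R : comPzRingType) := Ideal {
  ideal_set :> set R;
  ideal0 : ideal_set 0;
  idealD : forall x y, ideal_set x -> ideal_set y -> ideal_set (x + y);
  idealM : forall a x, ideal_set x -> ideal_set (a * x)
}.

Definition ideal_pred (R : comPzRingType) (I : ideal R) : R -> bool :=
  fun x => `[< ideal_set I x >].

Section Quotient.
Variables (R : comPzRingType) (I : ideal R).

Fact ideal_zmod_closed : zmod_closed (ideal_pred I).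
Proof.
split=> [|x y /asboolP Ix /asboolP Iy]; apply/asboolP; first exact: ideal0.
by apply: idealD => //; rewrite -mulN1r; apply: idealM.
Qed.

HB.instance Definition _ :=
  GRing.isZmodClosed.Build R (ideal_pred I) ideal_zmod_closed.

Definition ideal_zmod : zmodClosed R := GRing.ZmodClosed.clone R (ideal_pred I) _.

(* The additive quotient is ring_quotient's, which asks nothing more of I than
   being a subgroup; its ring structure is built below, since the library only
   provides it for proper ideals. *)
Definition quot_ring : Type := {ideal_quot ideal_zmod}.
HB.instance Definition _ := GRing.Zmodule.on quot_ring.

Definition quot_pi : R -> quot_ring := \pi_{ideal_quot ideal_zmod}%qT.

Lemma quot_pi_surj (c : quot_ring) : exists x, quot_pi x = c.
Proof. by exists (repr c); apply: reprK. Qed.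

Lemma quot_piE x y : quot_pi x = quot_pi y <-> ideal_set I (x - y).
Proof.
split=> [/eqP|Ixy]; first by rewrite -Quotient.idealrBE => /asboolP.
by apply/eqP; rewrite -Quotient.idealrBE; apply/asboolP.
Qed.

Fact quot_pi_zmod_morphism : zmod_morphism quot_pi.
Proof. exact: pi_is_zmod_morphism. Qed.

Definition quot_mul (c d : quot_ring) : quot_ring :=
  quot_pi (repr c * repr d).

Fact quot_piM : {morph quot_pi : x y / x * y >-> quot_mul x y}.
Proof.
move=> x y; apply/quot_piE.
have Irepr z : ideal_set I (z - repr (quot_pi z)).
  by apply/quot_piE; rewrite /quot_pi reprK.
rewrite /quot_mul; set x' := repr _; set y' := repr _.
have -> : x * y - x' * y' = y * (x - x') + x' * (y - y').
  by rewrite !mulrBr addrA [y * x]mulrC [y * x']mulrC subrK.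
by apply: idealD; apply: idealM; apply: Irepr.
Qed.

Fact quot_mulA : associative quot_mul.
Proof.
move=> c d e; have [[x <-] [y <-] [z <-]] :=
  And3 (quot_pi_surj c) (quot_pi_surj d) (quot_pi_surj e).
by rewrite -!quot_piM mulrA.
Qed.

Fact quot_mulC : commutative quot_mul.
Proof. by move=> c d; rewrite /quot_mul mulrC. Qed.

Fact quot_mul1 : left_id (quot_pi 1) quot_mul.
Proof. by move=> c; have [x <-] := quot_pi_surj c; rewrite -quot_piM mul1r. Qed.

Fact quot_mulDl : left_distributive quot_mul +%R.
Proof.
have piD x y : quot_pi (x + y) = quot_pi x + quot_pi y.
  exact: (@raddfD _ _ (\pi_{ideal_quot ideal_zmod}%qT)) x y.
move=> c d e; have [[x <-] [y <-] [z <-]] :=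
  And3 (quot_pi_surj c) (quot_pi_surj d) (quot_pi_surj e).
by rewrite -piD -!quot_piM mulrDl piD.
Qed.

HB.instance Definition _ := GRing.Zmodule_isComPzRing.Build quot_ring
  quot_mulA quot_mulC quot_mul1 quot_mulDl.

HB.instance Definition _ :=
  GRing.isZmodMorphism.Build R quot_ring quot_pi quot_pi_zmod_morphism.
HB.instance Definition _ :=
  GRing.isMonoidMorphism.Build R quot_ring quot_pi (conj erefl quot_piM).

End Quotient.

(* GRing.unit is not available on R / I, which may be the zero ring. *)
Definition units (S : comPzRingType) : set S :=
  [set x | exists y, x * y = 1].
Arguments units : clear implicits.

Lemma units_unitr (S : comUnitRingType) : units S = [set` GRing.unit].
Proof.
apply/seteqP; split=> x /=; last by exists x^-1; rewrite divrr.
by case=> y xy1; apply/unitrPr; exists y.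
Qed.

Section UnitGroup.
Variable S : comPzRingType.

Definition unit_group : Type := units S.
HB.instance Definition _ := Choice.on unit_group.

Definition unit_val (u : unit_group) : S := \val u.

Lemma unit_val_inj : injective unit_val.
Proof. exact: val_inj. Qed.

Lemma unit_valP u : units S (unit_val u).
Proof. exact: set_valP. Qed.

Definition mk_unit (x : S) (ux : units S x) : unit_group :=
  exist _ x (mem_set ux).

Fact units1 : units S 1.
Proof. by exists 1; rewrite mulr1. Qed.

Fact unitsM x y : units S x -> units S y -> units S (x * y).
Proof.
by move=> [x' xx'] [y' yy']; exists (x' * y'); rewrite mulrACA xx' yy' mulr1.
Qed.

Definition unit_inv_val (u : unit_group) : S := sval (cid (unit_valP u)).

Fact unit_valV (u : unit_group) : unit_val u * unit_inv_val u = 1.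
Proof. by rewrite /unit_inv_val; case: cid. Qed.

Fact units_inv u : units S (unit_inv_val u).
Proof. by exists (unit_val u); rewrite mulrC unit_valV. Qed.

Definition unit_one := mk_unit units1.
Definition unit_mul (u v : unit_group) :=
  mk_unit (unitsM (unit_valP u) (unit_valP v)).
Definition unit_inv (u : unit_group) := mk_unit (units_inv u).

Fact unit_mulA : associative unit_mul.
Proof. by move=> u v w; apply: unit_val_inj; apply: mulrA. Qed.
Fact unit_mul1g : left_id unit_one unit_mul.
Proof. by move=> u; apply: unit_val_inj; apply: mul1r. Qed.
Fact unit_mulg1 : right_id unit_one unit_mul.
Proof. by move=> u; apply: unit_val_inj; apply: mulr1. Qed.
Fact unit_mulgV : right_inverse unit_one unit_inv unit_mul.
Proof. by move=> u; apply: unit_val_inj; apply: unit_valV. Qed.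
Fact unit_mulVg : left_inverse unit_one unit_inv unit_mul.
Proof. by move=> u; apply: unit_val_inj; rewrite -[RHS](unit_valV u) mulrC. Qed.

HB.instance Definition _ := isGroup.Build unit_group
  unit_mulA unit_mul1g unit_mulg1 unit_mulVg unit_mulgV.

End UnitGroup.

Section UnitMap.
Variables (S T : comPzRingType) (f : {rmorphism S -> T}).

Fact rmorph_units x : units S x -> units T (f x).
Proof. by move=> [y xy1]; exists (f y); rewrite -rmorphM xy1 rmorph1. Qed.

Definition unit_map (u : unit_group S) : unit_group T :=
  mk_unit (rmorph_units (unit_valP u)).

Fact unit_map_monoid_morphism :
  unit_map 1%g = 1%g /\ {morph unit_map : u v / (u * v)%g}.
Proof.
by split=> [|u v]; apply: unit_val_inj; [apply: rmorph1 | apply: rmorphM].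
Qed.

HB.instance Definition _ := isUMagmaMorphism.Build
  (unit_group S) (unit_group T) unit_map unit_map_monoid_morphism.

End UnitMap.

Definition has_star (R : comPzRingType) (I : ideal R) : Prop :=
  set_surj [set: unit_group R] [set: unit_group (quot_ring I)]
    (unit_map (@quot_pi R I)).

Definition saturation (R : comPzRingType) (W : set R) : set R :=
  [set r | exists s, W (s * r)].

Definition saturated (R : comPzRingType) (W : set R) : Prop :=
  W = saturation W.

Definition units_plus (R : comPzRingType) (I : ideal R) : set R :=
  [set u + x | u in units R & x in I].

Definition one_plus (R : comPzRingType) (I : ideal R) : set R :=
  [set 1 + x | x in I].

(* Main.v *)
Require Import Defs.
From mathcomp Require Import all_boot all_algebra.
From mathcomp Require Import boolp classical_sets functions.

(** Everything is read off inverses modulo [I]: [a] lies in [R^* + I] iff some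
unit of [R] inverts [a] modulo [I], whereas [a] lies in the saturation of
[1 + I] iff some element of [R] does, i.e. iff the class of [a] is a unit of
[R / I]. *)

Import GRing.Theory.

Local Open Scope ring_scope.

Section Ideal.
Context {R : comPzRingType} (I : ideal R).
Implicit Types a x y : R.

Lemma idealN x : ideal_set I x -> ideal_set I (- x).
Proof. by rewrite -mulN1r; apply: idealM. Qed.

Lemma idealBC x y : ideal_set I (x - y) -> ideal_set I (y - x).
Proof. by move=> /idealN; rewrite opprB. Qed.

(** If [a = u + x] with [u] a unit and [x] in [I], the inverse of [u] also inverts [a] modulo [I].
    Conversely, if a unit inverts [a] modulo [I], its own inverse is congruent to [a]. *)
Lemma units_plusP a :
  units_plus I a <-> exists u, units R u /\ ideal_set I (1 - a * u).
Proof.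
split=> [[u [v uv1] [x Ix <-]]|[v [[u vu1] Iav]]].
  exists v; split; first by exists u; rewrite mulrC.
  by rewrite mulrDl uv1 opprD addrA subrr sub0r mulrC; apply/idealN/idealM.
exists u; first by exists v; rewrite mulrC.
exists (a - u); last by rewrite addrC subrK.
apply: idealBC; suff -> : u - a = u * (1 - a * v) by apply: idealM.
by rewrite mulrBr mulr1 mulrCA [u * v]mulrC vu1 mulr1.
Qed.

Lemma saturation_one_plusP a :
  saturation (one_plus I) a <-> exists b, ideal_set I (1 - a * b).
Proof.
split=> [[b [x Ix ba]]|[b Iab]]; exists b.
  by rewrite mulrC -ba opprD addrA subrr sub0r; apply: idealN.
by exists (b * a - 1); [rewrite mulrC; apply: idealBC | rewrite addrC subrK].
Qed.

Lemma sub_saturation (W : set R) : (W `<=` saturation W)%classic.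
Proof. by move=> a Wa; exists 1; rewrite mul1r. Qed.

Lemma units_quot_piP a :
  units (quot_ring I) (quot_pi I a) <-> exists b, ideal_set I (1 - a * b).
Proof.
split=> [[c]|[b Iab]].
  have [b <-] := quot_pi_surj c.
  by rewrite -rmorphM -(rmorph1 (quot_pi I)) => /quot_piE/idealBC; exists b.
exists (quot_pi I b); rewrite -rmorphM -(rmorph1 (quot_pi I)).
exact/quot_piE/idealBC.
Qed.

(** Lying in [units_plus I] means being congruent to a unit of [R], so surjectivity on unit groups
    can be tested on representatives. *)
Lemma has_starP :
  has_star I <->
  forall a, units (quot_ring I) (quot_pi I a) -> units_plus I a.
Proof.
split=> [star a ua|lift c _].
  have [u _ /(congr1 (@unit_val _))/= /quot_piE Iua] := star (mk_unit ua) Logic.I.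
  exists (unit_val u); first exact: unit_valP.
  by exists (a - unit_val u); [apply: idealBC | rewrite addrC subrK].
have [a ac] := quot_pi_surj (unit_val c).
have /lift[u uu [x Ix uxa]] : units (quot_ring I) (quot_pi I a).
  by rewrite ac; apply: unit_valP.
exists (mk_unit uu) => //; apply: unit_val_inj; rewrite -ac.
by apply/quot_piE/idealBC; rewrite -uxa /= addrC addKr.
Qed.

End Ideal.

Theorem proposition1p1 (R : comNzRingType) (I : ideal R) :
  [<-> has_star I;
       saturated (units_plus I);
       units_plus I = saturation (one_plus I);
       forall a : R, (exists b : R, ideal_set I (1 - a * b)) ->
         exists u : R, units R u /\ ideal_set I (1 - a * u)].
Proof.
tfae.
- move=> /has_starP star; apply/seteqP; split; first exact: sub_saturation.
  (* Since [v] inverts [s * a] modulo [I], [s * v] inverts [a], whose class is then a unit. *)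
  move=> a [s /units_plusP[v [_ Isav]]]; apply/star/units_quot_piP.
  by exists (s * v); rewrite mulrA [a * s]mulrC.
- move=> sat; apply/seteqP; split=> a.
    by move=> /units_plusP[u [_ Iau]]; apply/saturation_one_plusP; exists u.
  (* By saturation it suffices that the multiple [b * a = 1 + x] lies in [units_plus I], with unit
     part [1]. *)
  move=> [b [x Ix ba]]; rewrite sat; exists b; exists 1; first exact: units1.
  by exists x.
(* Through the two characterizations, the equality upgrades an inverse modulo [I] to a unit one. *)
- by move=> eqW a /saturation_one_plusP; rewrite -eqW => /units_plusP.
- move=> lift; apply/has_starP => a /units_quot_piP Ia.
  exact/units_plusP/lift.
Qed.
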